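(* Let $p$ be a prime and let $s,a$ be positive integers such that $s$ is even. Let $N_{\rm H}({\rm GR}(p^2,s),p^a)$ denote the number of Hermitian self-dual cyclic codes of length $p^a$ over the Galois ring ${\rm GR}(p^2,s)$. Then \[N_{\rm H}({\rm GR}(p^2,s),p^a)= \sum_{i_1=0}^{p^{a-1}} p^{s i_1/2}= \frac{p^{s(p^{a-1}+1)/2}-1}{p^{s/2}-1}.\]
   Context: ${\rm GR}(p^2,s)$ is the Galois ring of characteristic $p^2$ and degree $s$, i.e. the Galois extension of $\mathbb{Z}_{p^2}$ of degree $s$ (it has $p^{2s}$ elements and residue field $\mathbb{F}_{p^s}$). Its Teichmüller set is $\mathcal{T}_s=\{0,1,\xi,\dots,\xi^{p^s-2}\}$, where $\xi$ is an element of multiplicative order $p^s-1$; every $\alpha\in{\rm GR}(p^2,s)$ is uniquely $\alpha=a_0+b_0p$ with $a_0,b_0\in\mathcal{T}_s$. For $s$ even, $\overline{\alpha}=a_0^{p^{s/2}}+b_0^{p^{s/2}}p$ defines a ring automorphism of ${\rm GR}(p^2,s)$. A cyclic code of length $n$ over ${\rm GR}(p^2,s)$ is a ${\rm GR}(p^2,s)$-submodule of ${\rm GR}(p^2,s)^n$ invariant under the cyclic shift; equivalently (identifying $(c_0,\dots,c_{n-1})$ with $\sum_i c_iX^i$) an ideal of ${\rm GR}(p^2,s)[X]/\langle X^n-1\rangle$. The Hermitian dual $C^{\perp_{\rm H}}$ of $C$ is the dual with respect to the form $\langle \boldsymbol{u},\boldsymbol{v}\rangle_{\rm H}=\sum_{i=0}^{n-1}u_i\overline{v_i}$,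 and $C$ is Hermitian self-dual if $C=C^{\perp_{\rm H}}$. *)

(* Defs.v *)
From HB Require Import structures.
From mathcomp Require Import all_boot all_order all_algebra.

Set Implicit Arguments.
Unset Strict Implicit.
Unset Printing Implicit Defensive.

Import GRing.Theory.
Local Open Scope ring_scope.

(* Used only for p prime, so that 'Z_(p ^ 2) is Z/p^2Z, 'F_p is Z/pZ, and this
   is the canonical ring morphism. *)
Definition redp (p : nat) (x : 'Z_(p ^ 2)) : 'F_p := (x : nat)%:R.

(* R is a copy of GR(p^2, s): it is isomorphic to Z_{p^2}[X] / (f) for a monic f
   of degree s that is irreducible modulo p. The isomorphism is given as a
   surjective morphism phi from Z_{p^2}[X] with kernel (f). *)
Definition is_galois_ring (p s : nat) (R : finComNzRingType) : Prop :=
  exists f : {poly 'Z_(p ^ 2)},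
    [/\ f \is monic,
        size f = s.+1,
        irreducible_poly (map_poly (@redp p) f) &
        exists phi : {rmorphism {poly 'Z_(p ^ 2)} -> R},
          (forall r : R, exists g, phi g = r) /\
          (forall g, phi g = 0 <-> exists h, g = h * f)].

Definition teichmuller (p s : nat) (R : finComNzRingType) (xi : R) : {set R} :=
  0 |: [set xi ^+ (i : nat) | i : 'I_(p ^ s - 1)].

(* The Teichmueller expansion alpha = a0 + b0 p exists and is unique when R is a
   copy of GR(p^2, s) and xi has order p^s - 1; the None branch is then never
   taken and the result of [pick] is that expansion. *)
Definition hconj (p s : nat) (R : finComNzRingType) (xi alpha : R) : R :=
  if [pick ab : R * R | [&& ab.1 \in teichmuller p s xi,
                            ab.2 \in teichmuller p s xi &
                            alpha == ab.1 + ab.2 * p%:R]] is Some ab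
  then ab.1 ^+ (p ^ s./2) + ab.2 ^+ (p ^ s./2) * p%:R
  else 0.

Section Codes.

Variables (R : finComNzRingType) (n : nat).

Definition is_linear_code (C : {set 'rV[R]_n}) : bool :=
  (0 \in C) &&
  [forall r : R, forall u in C, forall v in C, r *: u + v \in C].

(* (c_0, ..., c_{n-1}) is sent to (c_{n-1}, c_0, ..., c_{n-2}). *)
Definition cyclic_shift (u : 'rV[R]_n) : 'rV[R]_n := \row_i u 0 (ord_pred i).

Definition is_cyclic_code (C : {set 'rV[R]_n}) : bool :=
  is_linear_code C && [forall u in C, cyclic_shift u \in C].

Variables (p s : nat) (xi : R).

Definition hform (u v : 'rV[R]_n) : R :=
  \sum_(i < n) u 0 i * hconj p s xi (v 0 i).

Definition hdual (C : {set 'rV[R]_n}) : {set 'rV[R]_n} :=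
  [set u | [forall v in C, hform u v == 0]].

End Codes.

Definition num_hsd_cyclic (R : finComNzRingType) (p s : nat) (xi : R)
    (n : nat) : nat :=
  #|[set C : {set 'rV[R]_n} | is_cyclic_code C && (C == hdual p s xi C)]|.

(* Main.v *)
From HB Require Import structures.
Require Import Defs.
From mathcomp Require Import all_boot all_order all_algebra.
From mathcomp Require Import qpoly ring.

(** Let A = R[X]/(X^n - 1) with n = p^a, let y = X - 1, and let * be the
    involution of A that sends X to X^-1 and acts on R by [hconj]. The form is
    the constant coefficient of u v^*, so the self-dual codes are the ideals I
    that equal the annihilator of I^*. Modulo p, A is the chain ring F[y]/(y^n);
    moreover y^* is a unit times y, and y^n = p u y^M with u a unit and
    M = p^(a-1).

    A self-dual I is generated by some g = y^(n-j) + p h and by p y^j; it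
    contains y^j g, hence p y^M, which forces j <= M. Conversely (g, p y^j) is
    self-dual as soon as g g^* = 0. With z = p h (y^(n-j))^* this is a trace
    equation z + z^* = d on p y^(n-j) A, a group of order p^(sj), and it has
    p^(sj/2) solutions, in bijection with the ideals of index j. *)

Set Implicit Arguments.
Unset Strict Implicit.
Unset Printing Implicit Defensive.

Import GRing.Theory.
Local Open Scope ring_scope.

(** * Self-dual ideals *)

Lemma card_fibers (aT rT : finType) (f : aT -> rT) (S : {set aT})
    (D : {set rT}) (k : nat) :
    {in S, forall x, f x \in D} ->
    {in D, forall d, #|[set x in S | f x == d]| = k} ->
  #|S| = (#|D| * k)%N.
Proof.
move=> fSD fk; rewrite -sum1_card (partition_big f [in D]) //=.
rewrite -sum_nat_const; apply: eq_bigr => d dD.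
by rewrite -(fk d dD) -sum1_card; apply: eq_bigl => x; rewrite !inE.
Qed.

Lemma card_bij (aT rT : finType) (f : aT -> rT) (g : rT -> aT)
    (S : {set aT}) (D : {set rT}) :
    {in S, forall x, f x \in D /\ g (f x) = x} ->
    {in D, forall y, g y \in S /\ f (g y) = y} ->
  #|S| = #|D|.
Proof.
move=> fP gP; have injf : {in S &, injective f}.
  by move=> x y xS yS fxy; rewrite -(fP x xS).2 fxy (fP y yS).2.
rewrite -(card_in_imset injf); apply: eq_card => y; apply/imsetP/idP.
  by case=> x xS ->; exact: (fP x xS).1.
by move=> yD; exists (g y); [exact: (gP y yD).1 | rewrite (gP y yD).2].
Qed.

Definition invertible (A : comNzRingType) (a : A) : Prop := exists v, a * v = 1.

(** * Units and nilpotent perturbations *)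

Section Units.
Variable A : comNzRingType.
Implicit Types a b v : A.

Lemma invertible1 : invertible (1 : A).
Proof. by exists 1; rewrite mulr1. Qed.

Lemma invertibleX a n : invertible a -> invertible (a ^+ n).
Proof. by case=> v av; exists (v ^+ n); rewrite -exprMn av expr1n. Qed.

Lemma invertibleN a : invertible a -> invertible (- a).
Proof. by case=> v av; exists (- v); rewrite mulrNN. Qed.

Lemma invertible_cancel a b : invertible a -> a * b = 0 -> b = 0.
Proof. by case=> v av ab; rewrite -[b]mul1r -av mulrAC ab mul0r. Qed.

(** With [a * v = 1], the inverse of [1 + v * b] is a finite geometric series, read off from the
    factorisation of [1 - (- (v * b)) ^+ n]. *)
Lemma invertibleD_nilp a b n : invertible a -> b ^+ n = 0 -> invertible (a + b).
Proof.
case=> v av bn; have := subrXX 1 (- (v * b)) n.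
rewrite exprNn exprMn bn mulr0 mulr0 subr0 expr1n opprK => h.
exists (v * \sum_(i < n) 1 ^+ (n.-1 - i) * (- (v * b)) ^+ i).
by rewrite mulrA mulrDl av [b * v]mulrC.
Qed.

End Units.

(** The kernel of multiplication by [x] coincides with its image, so all fibres over the image have
    the size of the image. *)
Lemma card_mul_ann (A : finComNzRingType) (x : A) :
    x * x = 0 -> (forall a, x * a = 0 -> exists b, a = x * b) ->
  #|A| = (#|[set (x * a)%R | a : A]| * #|[set (x * a)%R | a : A]|)%N.
Proof.
move=> xx annx; rewrite -cardsT.
apply: (card_fibers (f := fun a => x * a)) => [a _|_ /imsetP[a _ ->]].
  exact: imset_f.
apply: (card_bij (f := fun b => b - a) (g := fun b => b + a)) => b.
  rewrite !inE /= => /eqP h; split; last by rewrite subrK.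
  have /annx[c ->] : x * (b - a) = 0 by rewrite mulrBr h subrr.
  exact: imset_f.
case/imsetP=> c _ ->; rewrite !inE /= addrK; split=> //.
by rewrite mulrDr mulrA xx mul0r add0r.
Qed.

Definition is_ideal (A : finComNzRingType) (I : {set A}) : bool :=
  (0 \in I) && [forall r : A, forall u in I, forall v in I, r * u + v \in I].

Lemma is_idealP (A : finComNzRingType) (I : {set A}) :
  reflect (0 \in I /\ forall r u v, u \in I -> v \in I -> r * u + v \in I)
          (is_ideal I).
Proof.
apply: (iffP andP) => -[I0 IP]; split=> //.
  move=> r u v uI vI.
  by have /forallP/(_ r)/forall_inP/(_ u uI)/forall_inP/(_ v vI) := IP.
apply/forallP=> r; apply/forall_inP=> u uI.
by apply/forall_inP=> v vI; apply: IP.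
Qed.

Definition conj_ann (A : finComNzRingType) (star : A -> A) (I : {set A}) :=
  [set x | [forall v in I, x * star v == 0]].

Lemma conj_annP (A : finComNzRingType) (star : A -> A) (I : {set A}) x :
  reflect (forall v, v \in I -> x * star v = 0) (x \in conj_ann star I).
Proof.
rewrite inE; apply: (iffP forall_inP) => h v vI; first exact/eqP/h.
exact/eqP/h.
Qed.

(* For codes of length p^a: x = p, y = X - 1, N = p^a, M = p^(a-1),
   q = p^(s/2), and T is the Teichmueller set. *)
Section SelfDualIdeals.

Variables (A : finComNzRingType) (star : {rmorphism A -> A}).
Variables (x y u w alpha theta : A) (T : {set A}) (q N M : nat).

Hypotheses (starK : involutive star) (q_gt1 : (1 < q)%N).
Hypotheses (xx : x * x = 0) (annx : forall a, x * a = 0 -> exists b, a = x * b).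
Hypothesis cardA : #|A| = (q ^ (4 * N))%N.
Hypothesis cardT : (#|T| <= q ^ 2)%N.
Hypothesis T_unit : {in T, forall t, t = 0 \/ invertible t}.
Hypothesis dec : forall a, exists t b c, t \in T /\ a = t + y * b + x * c.
Hypotheses (star_x : star x = x) (star_y : star y = w * y).
Hypotheses (w_unit : invertible w) (u_unit : invertible u).
Hypothesis yN : y ^+ N = x * u * y ^+ M.
Hypothesis leMN : (M.*2 <= N)%N.
Hypotheses (alphaP : alpha + star alpha = 1) (theta_unit : invertible theta).
Hypothesis star_theta : star theta = - theta.

(** * The descending chain of ideals x y^k A *)

Let V k := [set x * y ^+ k * a | a : A].

Let VP k z : reflect (exists a, z = x * y ^+ k * a) (z \in V k).
Proof.
apply: (iffP imsetP) => [[a _ ->]|[a ->]]; [by exists a | by exists a].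
Qed.

Let xyN : x * y ^+ N = 0.
Proof. by rewrite yN !mulrA xx !mul0r. Qed.

Let xyN_le k : (N <= k)%N -> x * y ^+ k = 0.
Proof. by move=> /subnKC <-; rewrite exprD mulrA xyN mul0r. Qed.

Let y_nilp : y ^+ (N + N) = 0.
Proof. by rewrite exprD {1}yN mulrAC [x * u * _]mulrAC xyN !mul0r. Qed.

Let invertible_add v b c :
  invertible v -> invertible (v + y * b + x * c).
Proof.
move=> vU; apply: (@invertibleD_nilp _ _ _ 2); last first.
  by rewrite exprMn expr2 xx mul0r.
apply: (@invertibleD_nilp _ _ _ (N + N)) => //.
by rewrite exprMn y_nilp mul0r.
Qed.

(** Modulo [x] the ring is a chain ring: powers of [y] are split off until the leading digit in [T]
    is a unit or the exponent reaches [N]. *)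
Let normal_form a :
  exists l v c, [/\ (l <= N)%N, invertible v & a = v * y ^+ l + x * c].
Proof.
suff H k : (k <= N)%N ->
    (exists l v c, [/\ (l <= N)%N, invertible v & a = v * y ^+ l + x * c])
    \/ exists b c, a = y ^+ k * b + x * c.
  have [//|[b [c ->]]] := H N (leqnn N).
  (* Since y^N lies in xA, the difference y^N (b - 1) is absorbed into the [x] part and the unit can
     be 1. *)
  exists N, 1, (c + u * y ^+ M * (b - 1)); split=> //; first exact: invertible1.
  by rewrite yN; ring.
elim: k => [_|k IHk ltkN].
  by right; exists a, 0; rewrite mul1r mulr0 addr0.
have [|[b [c ab]]] := IHk (ltnW ltkN); first by left.
have [t [b' [c' [tT bE]]]] := dec b.
have [t0|tU] := T_unit tT.
  by right; exists b', (c + y ^+ k * c'); rewrite ab bE t0 exprSr; ring.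
left; exists k, (t + y * b' + x * c'), c; split; first exact: ltnW.
  exact: invertible_add.
by rewrite ab bE; ring.
Qed.

Let leVS k : (#|V k| <= q ^ 2 * #|V k.+1|)%N.
Proof.
apply: leq_trans (leq_mul cardT (leqnn _)); rewrite -cardsX.
apply: leq_trans (leq_imset_card (fun z => x * y ^+ k * z.1 + z.2) _).
apply/subset_leq_card/subsetP => _ /VP[a ->].
have [t [b [c [tT ->]]]] := dec a.
apply/imsetP; exists (t, x * y ^+ k.+1 * b) => /=.
  by rewrite inE /= tT; apply/VP; exists b.
rewrite exprSr.
transitivity (x * y ^+ k * t + x * (y ^+ k * y) * b + x * x * y ^+ k * c).
  by ring.
by rewrite xx !mul0r addr0.
Qed.

Let leVD i k : (#|V k| <= (q ^ 2) ^ i * #|V (i + k)|)%N.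
Proof.
elim: i => [|i IHi]; first by rewrite mul1n.
by apply: leq_trans IHi _; rewrite (expnSr (q ^ 2)) -mulnA leq_mul2l leVS orbT.
Qed.

(** Each of the N steps from [V 0] down to [V N = 0] has index at most q^2, while [V 0] = xA has
    q^(2N) elements, the square root of the order of A. Hence every step has index exactly q^2. *)
Let cardV k : (k <= N)%N -> #|V k| = ((q ^ 2) ^ (N - k))%N.
Proof.
move=> lekN; have VN : #|V N| = 1%N.
  apply/eqP/cards1P; exists 0; apply/setP=> z; rewrite inE.
  apply/VP/eqP => [[a ->]|->]; first by rewrite xyN mul0r.
  by exists 0; rewrite mulr0.
have V0 : #|V 0| = ((q ^ 2) ^ N)%N.
  have := card_mul_ann xx annx; rewrite cardA.
  have -> : [set x * a | a : A] = V 0 by apply: eq_imset => a; rewrite mulr1.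
  have -> : (q ^ (4 * N) = (q ^ 2) ^ N * (q ^ 2) ^ N)%N.
    by rewrite -expnM -expnD -mulnDl.
  by move/eqP; rewrite !mulnn eqn_sqr => /eqP ->.
apply/eqP; rewrite eqn_leq; apply/andP; split.
  by have := leVD (N - k) k; rewrite subnK // VN muln1.
have := leVD k 0; rewrite addn0 V0 -{1}(subnK lekN) expnD mulnC leq_pmul2l //.
by rewrite !expn_gt0 (ltnW q_gt1).
Qed.

Let xy_eq0 k : (x * y ^+ k == 0) = (N <= k)%N.
Proof.
apply/eqP/idP => [xyk|/xyN_le //]; rewrite leqNgt; apply/negP => ltkN.
have := cardV (ltnW ltkN); suff -> : V k = [set 0].
  have q2_gt1 : (1 < q ^ 2)%N.
    by apply: leq_trans q_gt1 _; rewrite leq_pmull // ltnW.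
  move=> h; have := eqn_exp2l 0 (N - k) q2_gt1.
  by rewrite -h cards1 expn0 eqxx eq_sym subn_eq0 leqNgt ltkN.
apply/setP=> z; rewrite inE; apply/VP/eqP => [[a ->]|->].
  by rewrite xyk mul0r.
by exists 0; rewrite mulr0.
Qed.

(** For a = v y^l + x c in normal form the product is v x y^(k+l), which vanishes only if N <= k +
    l. *)
Let ann_xy k a : (k <= N)%N -> x * y ^+ k * a = 0 ->
  exists b c, a = y ^+ (N - k) * b + x * c.
Proof.
move=> lekN; have [l [v [c [lelN vU ->]]]] := normal_form a => h.
have : x * y ^+ (k + l) == 0.
  apply/eqP/(invertible_cancel vU).
  rewrite -h; transitivity (v * (x * y ^+ (k + l)) + x * x * (y ^+ k * c)).
    by rewrite xx mul0r addr0.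
  by rewrite exprD; ring.
rewrite xy_eq0 addnC -leq_subLR => lel; exists (v * y ^+ (l - (N - k))), c.
by rewrite mulrCA -exprD subnKC // leq_subLR addnC -leq_subLR.
Qed.

(** * The ideals (g, x y^j): self-duality and classification *)

Let code j g := [set g * z.1 + x * y ^+ j * z.2 | z : A * A].

Let codeP j g z :
  reflect (exists a b, z = g * a + x * y ^+ j * b) (z \in code j g).
Proof.
apply: (iffP imsetP) => [[[a b] _ ->]|[a [b ->]]]; first by exists a, b.
by exists (a, b).
Qed.

(** The first generators [g] that will make [code j g] self-dual. *)
Let gens j := [set g | [exists h, g == y ^+ (N - j) + x * h] & g * star g == 0].

Let gensP j g : reflect
  ((exists h, g = y ^+ (N - j) + x * h) /\ g * star g = 0) (g \in gens j).
Proof.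
rewrite inE; apply: (iffP andP).
  by case=> /existsP[h /eqP gE] /eqP gg; split=> //; exists h.
by case=> -[h gE] gg; split; [apply/existsP; exists h; apply/eqP | apply/eqP].
Qed.

Let star_yX k : star (y ^+ k) = w ^+ k * y ^+ k.
Proof. by rewrite rmorphXn star_y exprMn. Qed.

Let x_star_gen j g : g \in gens j ->
  x * star g = w ^+ (N - j) * (x * y ^+ (N - j)).
Proof.
case/gensP=> -[h ->] _; rewrite rmorphD rmorphM star_x star_yX mulrDr mulrA.
by rewrite mulrA xx mul0r addr0 mulrCA mulrA.
Qed.

Let x_star_gen_eq0 j g a : (j <= N)%N -> g \in gens j ->
  x * a * star g = 0 -> exists b c, a = y ^+ j * b + x * c.
Proof.
move=> lejN gG; rewrite mulrAC (x_star_gen gG) -mulrA.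
move=> /(invertible_cancel (invertibleX _ w_unit)) /ann_xy.
by rewrite subKn //; apply; rewrite leq_subr.
Qed.

Let xyj_gen j g : (j <= N)%N -> g \in gens j -> x * y ^+ j * star g = 0.
Proof.
move=> lejN gG; rewrite mulrAC (x_star_gen gG) -mulrA -mulrA -exprD subnK //.
by rewrite xyN mulr0.
Qed.

Let gen_xyj j g : (j <= N)%N -> g \in gens j -> g * (x * star (y ^+ j)) = 0.
Proof.
move=> lejN gG; have := congr1 star (xyj_gen lejN gG).
by rewrite !rmorphM star_x starK rmorph0 => <-; ring.
Qed.

Let code_ideal j g : is_ideal (code j g).
Proof.
apply/is_idealP; split; first by apply/codeP; exists 0, 0; rewrite !mulr0 addr0.
move=> r _ _ /codeP[a [b ->]] /codeP[a' [b' ->]].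
by apply/codeP; exists (r * a + a'), (r * b + b'); ring.
Qed.

(** All products of a generator with a conjugate generator vanish, which gives one inclusion.
    Conversely, killing the conjugate of x y^j forces z = y^(N-j) b modulo x; then z - g b is a
    multiple of x killing [star g], hence lies in [V j]. *)
Let code_self_dual j g : (j <= N)%N -> g \in gens j ->
  code j g = conj_ann star (code j g).
Proof.
move=> lejN gG; have [[h gE] gg] := gensP _ _ gG.
have xgg := xyj_gen lejN gG.
have gxg := gen_xyj lejN gG.
apply/setP=> z; apply/codeP/conj_annP => [[a [b ->]] _ /codeP[a' [b' ->]]|zP].
  rewrite rmorphD !rmorphM star_x.
  transitivity (g * star g * (a * star a') + x * y ^+ j * star g * (b * star a')
    + g * (x * star (y ^+ j)) * (a * star b')
    + x * x * (y ^+ j * star (y ^+ j) * b * star b')); first by ring.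
  by rewrite gg xgg gxg xx !mul0r !addr0.
have zg : z * star g = 0.
  by apply: zP; apply/codeP; exists 1, 0; rewrite mulr1 mulr0 addr0.
have /(invertible_cancel (invertibleX j w_unit)) zxy :
    w ^+ j * (x * y ^+ j * z) = 0.
  have := zP (x * y ^+ j); rewrite rmorphM star_x star_yX => <-; first by ring.
  by apply/codeP; exists 0, 1; rewrite mulr0 mulr1 add0r.
have [b [c zE]] := ann_xy lejN zxy.
have zE' : z = g * b + x * (c - h * b) by rewrite zE gE; ring.
have /(x_star_gen_eq0 lejN gG)[b' [c' cE]] : x * (c - h * b) * star g = 0.
  by rewrite -zg zE' mulrDl [g * b * _]mulrAC gg mul0r add0r.
exists b, b'; rewrite {1}zE' cE mulrDr [x * (x * _)]mulrA xx mul0r addr0.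
by rewrite mulrA.
Qed.

(** Recovers [j] from the ideal as the least exponent k with x y^k in it: such an element must kill
    [star g], a unit times y^(N-j) modulo x. *)
Let code_index j g k : (j <= N)%N -> g \in gens j ->
  x * y ^+ k \in code j g -> (j <= k)%N.
Proof.
move=> lejN gG; rewrite (code_self_dual lejN gG) => /conj_annP/(_ g).
rewrite mulrAC (x_star_gen gG) -!mulrA -exprD => h.
have /h/(invertible_cancel (invertibleX _ w_unit))/eqP : g \in code j g.
  by apply/codeP; exists 1, 0; rewrite mulr1 mulr0 addr0.
by rewrite xy_eq0 -leq_subLR subKn.
Qed.

Let code_inj j g j' g' : (j <= N)%N -> (j' <= N)%N ->
  g \in gens j -> g' \in gens j' -> code j g = code j' g' -> j = j'.
Proof.
move=> lej lej' gG gG' E; apply/eqP; rewrite eqn_leq; apply/andP; split.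
  apply: (code_index lej gG); rewrite E; apply/codeP.
  by exists 0, 1; rewrite mulr0 mulr1 add0r.
apply: (code_index lej' gG'); rewrite -E; apply/codeP.
by exists 0, 1; rewrite mulr0 mulr1 add0r.
Qed.

Let self_dual_code I : is_ideal I -> I = conj_ann star I ->
  exists j g, [/\ (j <= M)%N, g \in gens j & I = code j g].
Proof.
move=> /is_idealP[I0 IP] IE.
have II z z' : z \in I -> z' \in I -> z * star z' = 0.
  by rewrite {1}IE => /conj_annP; apply.
have IM r z : z \in I -> r * z \in I.
  by move=> zI; rewrite -[r * z]addr0; apply: IP.
pose P i := [exists h, y ^+ i + x * h \in I].
have exP : exists i, P i.
  (* With this choice y^N + x h is 0. *)
  exists N; apply/existsP; exists (- (u * y ^+ M)).
  by rewrite yN mulrN mulrA subrr.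
case: (ex_minnP exP) => i /existsP[h gI] imin.
have leiN : (i <= N)%N.
  apply: imin; apply/existsP; exists (- (u * y ^+ M)).
  by rewrite yN mulrN mulrA subrr.
set g := y ^+ i + x * h in gI.
(* By minimality of [i], every element of I has normal form exponent at least [i], so its conjugate
   is killed by x y^(N-i); self-duality puts that element in I. *)
have xyI : x * y ^+ (N - i) \in I.
  rewrite IE; apply/conj_annP => z zI.
  have [l [v [c [lelN vU zE]]]] := normal_form z.
  have lel : (i <= l)%N.
    case: vU => v' vv'; apply: imin; apply/existsP; exists (v' * c).
    have -> : y ^+ l + x * (v' * c) = v' * z.
      by rewrite zE mulrDr !mulrA [v' * v]mulrC vv' mul1r; ring.
    exact: IM.
  rewrite zE rmorphD !rmorphM star_x star_yX.
  transitivity (x * y ^+ (N - i + l) * (star v * w ^+ l) +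
    x * x * (y ^+ (N - i) * star c)); first by rewrite exprD; ring.
  rewrite xx xyN_le ?mul0r ?addr0 //.
  by rewrite -{1}(subnK leiN) leq_add2l.
have gG : g \in gens (N - i).
  apply/gensP; split; last exact: II.
  by exists h; rewrite subKn.
have leNi : (N - i <= N)%N by rewrite leq_subr.
have subI : code (N - i) g \subset I.
  apply/subsetP=> _ /codeP[a [b ->]].
  by rewrite mulrC; apply: IP => //; rewrite mulrC; apply: IM.
(* I kills its own conjugate, hence that of the smaller ideal, which is its own conjugate
   annihilator. *)
have IC : I = code (N - i) g.
  apply/eqP; rewrite eqEsubset subI andbT (code_self_dual leNi gG).
  apply/subsetP=> z zI; apply/conj_annP => v /(subsetP subI) vI; exact: II.
exists (N - i)%N, g; split=> //.
(* The bound j <= M: I contains y^(N-i) g - h x y^(N-i) = y^N = x u y^M, hence x y^M. *)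
apply: (code_index leNi gG); rewrite -IC.
have [u' uu'] := u_unit.
have -> : x * y ^+ M = u' * (y ^+ (N - i) * g + (- h) * (x * y ^+ (N - i))).
  have -> : y ^+ (N - i) * g + - h * (x * y ^+ (N - i)) = y ^+ (N - i) * y ^+ i.
    by rewrite /g; ring.
  rewrite -exprD subnK // yN mulrA [x * u]mulrC mulrA [u' * u]mulrC uu' mul1r.
  by [].
by apply: (IM); apply: IP => //; apply: IM.
Qed.

Let code_shift j g b : code j (g + x * y ^+ j * b) = code j g.
Proof.
have sub g' b' : code j (g' + x * y ^+ j * b') \subset code j g'.
  apply/subsetP=> _ /codeP[c [d ->]]; apply/codeP; exists c, (b' * c + d).
  by ring.
apply/eqP; rewrite eqEsubset sub /=.
have {1}-> : g = (g + x * y ^+ j * b) + x * y ^+ j * (- b) by ring.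
exact: sub.
Qed.

(** Two elements of [gens j] give the same ideal exactly when they differ by an element of [V j].
    The difference is a multiple of x killing [star g]; conversely, adding an element of [V j]
    changes neither the ideal nor the equation on [g]. *)
Let card_codes j : (j <= N)%N ->
  #|gens j| = (#|code j @: gens j| * (q ^ 2) ^ (N - j))%N.
Proof.
move=> lejN; apply: (card_fibers (f := code j)) => [g gG|].
  exact: imset_f.
move=> _ /imsetP[g gG ->]; rewrite -cardV //.
have [[h gE] gg] := gensP _ _ gG.
have gxg := gen_xyj lejN gG.
apply: (card_bij (f := fun g' => g' - g) (g := fun z => z + g)) => g'.
  rewrite inE => /andP[gG' /eqP E]; split; last by rewrite subrK.
  have [[h' gE'] gg'] := gensP _ _ gG'.
  have dE : g' - g = x * (h' - h) by rewrite gE gE'; ring.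
  have : g' - g \in code j g.
    have /is_idealP[_ IP] := code_ideal j g.
    rewrite addrC -mulN1r; apply: IP; last rewrite -E.
      by apply/codeP; exists 1, 0; rewrite mulr1 mulr0 addr0.
    by apply/codeP; exists 1, 0; rewrite mulr1 mulr0 addr0.
  rewrite (code_self_dual lejN gG) => /conj_annP/(_ g); rewrite dE => H.
  have /H/(x_star_gen_eq0 lejN gG)[b [c ->]] : g \in code j g.
    by apply/codeP; exists 1, 0; rewrite mulr1 mulr0 addr0.
  by apply/VP; exists b; rewrite mulrDr [x * (x * _)]mulrA xx mul0r addr0 mulrA.
case/VP=> b ->; rewrite addrK inE; split=> //; apply/andP; split; last first.
  by rewrite addrC code_shift.
apply/gensP; split; first by exists (h + y ^+ j * b); rewrite gE; ring.
rewrite rmorphD !rmorphM star_x.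
transitivity (x * y ^+ j * star g * b + g * star g
  + x * x * (y ^+ j * star (y ^+ j) * b * star b)
  + g * (x * star (y ^+ j)) * star b); first by ring.
by rewrite (xyj_gen lejN gG) gg xx gxg !mul0r !addr0.
Qed.

(** * The trace equation and the number of generators *)

Let starV k z : z \in V k -> star z \in V k.
Proof.
case/VP=> a ->; apply/VP; exists (w ^+ k * star a).
by rewrite !rmorphM star_x star_yX; ring.
Qed.

Let VD k z z' : z \in V k -> z' \in V k -> z + z' \in V k.
Proof.
by move=> /VP[a ->] /VP[b ->]; apply/VP; exists (a + b); rewrite mulrDr.
Qed.

Let VM k a z : z \in V k -> a * z \in V k.
Proof. by case/VP=> b ->; apply/VP; exists (a * b); rewrite mulrCA. Qed.

Let VN k z : z \in V k -> - z \in V k.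
Proof. by move=> ?; rewrite -mulN1r VM. Qed.

(* The trace equation z + star z = d on V k: alpha * d is a solution, and
   multiplication by theta exchanges its kernel with the fixed points. *)
Let card_trace_fiber k d : (k <= N)%N -> d \in V k -> star d = d ->
  #|[set z in V k | z + star z == d]| = (q ^ (N - k))%N.
Proof.
move=> lekN dV dfix; pose F := [set z in V k | star z == z].
have fib e : e \in F -> #|[set z in V k | z + star z == e]| = #|F|.
  rewrite inE => /andP[eV /eqP efix]; have [t' tt'] := theta_unit.
  have st' : star t' = - t'.
    rewrite -[star t']mulr1 -tt' mulrA.
    have -> : star t' * theta = - 1.
      rewrite -[theta]opprK -star_theta mulrN -rmorphM [t' * _]mulrC tt'.
      by rewrite rmorph1.
    by rewrite mulN1r.
  apply: (card_bij (f := fun z => theta * (z - alpha * e))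
                   (g := fun z => t' * z + alpha * e)) => z.
    rewrite !inE => /andP[zV /eqP zE]; split; last first.
      by rewrite mulrA [t' * _]mulrC tt' mul1r subrK.
    rewrite VM ?VD ?VN ?VM //= rmorphM star_theta rmorphB rmorphM efix.
    have -> : star z = e - z by rewrite -zE; ring.
    have -> : star alpha = 1 - alpha by rewrite -alphaP; ring.
    by apply/eqP; ring.
  rewrite !inE => /andP[zV /eqP zE]; split.
    rewrite VD ?VM //= rmorphD !rmorphM st' efix zE.
    have -> : star alpha = 1 - alpha by rewrite -alphaP; ring.
    by apply/eqP; ring.
  by rewrite addrK mulrA tt' mul1r.
have dF : d \in F by rewrite inE dV dfix eqxx.
(* The trace maps [V k] to [F], and each fibre is as large as [F], so the order of [F] is the square
   root of that of [V k]. *)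
rewrite fib //; have : #|V k| = (#|F| * #|F|)%N.
  apply: (card_fibers (f := fun z => z + star z)); last exact: fib.
  move=> z zV.
  by rewrite inE VD ?starV //= rmorphD starK addrC.
rewrite cardV // -expnM mulnC expnM => /eqP.
by rewrite [X in _ == X]mulnn eqn_sqr => /eqP <-.
Qed.

(** Put i = N - j and z = x h [star (y ^+ i)]. Expanding g [star g] with x^2 = 0 gives e + z +
    [star z], so [g] is admissible iff z has trace -e. There are q^j such z in [V i], and z
    determines [g] up to [V j]. *)
Let card_gens j : (j <= M)%N -> #|gens j| = (q ^ j * (q ^ 2) ^ (N - j))%N.
Proof.
move=> lejM; have leMN' : (M <= N)%N.
  by apply: leq_trans leMN; rewrite -addnn leq_addr.
have lejN := leq_trans lejM leMN'.
set i := (N - j)%N; have leiN : (i <= N)%N by rewrite leq_subr.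
pose e := y ^+ i * star (y ^+ i).
(* From 2j <= 2M <= N. Then y^(2i) = y^N y^d = x u y^(M-j) y^i, which is why [e] lies in [V i]. *)
have [d iE] : exists d, (i = j + d)%N.
  exists (i - j)%N; rewrite subnKC // /i leq_subRL //.
  by apply: leq_trans leMN; rewrite -addnn leq_add.
have eV : e \in V i.
  apply/VP; exists (w ^+ i * u * y ^+ (M - j)).
  have eE : e = w ^+ i * (y ^+ N * y ^+ d).
    rewrite /e star_yX mulrCA -!exprD; congr (_ * _ ^+ _).
    by rewrite {2}iE addnA subnK.
  have yiE : y ^+ i = y ^+ j * y ^+ d by rewrite -exprD -iE.
  have yME : y ^+ M = y ^+ (M - j) * y ^+ j by rewrite -exprD subnK.
  by rewrite eE yN yiE yME; ring.
have estar : star e = e by rewrite /e rmorphM starK mulrC.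
have i_sub : (N - i = j)%N by rewrite subKn.
rewrite -[X in (q ^ X * _)%N]i_sub -(card_trace_fiber leiN (VN eV)); last first.
  by rewrite rmorphN estar.
have wi_unit := invertibleX i w_unit; have [w' ww'] := wi_unit.
apply: (card_fibers (f := fun g => (g - y ^+ i) * star (y ^+ i))).
  move=> _ /gensP[[h ->]]; rewrite -/i => gg; rewrite inE; apply/andP; split.
    apply/VP; exists (w ^+ i * h); rewrite star_yX; ring.
  rewrite rmorphM rmorphB !rmorphD rmorphM starK -subr_eq0 opprK -gg.
  rewrite rmorphD rmorphM star_x /e; apply/eqP.
  transitivity (y ^+ i * star (y ^+ i) + x * h * star (y ^+ i) +
     x * star h * y ^+ i + x * x * (h * star h)); last by ring.
  by rewrite xx; ring.
move=> z; rewrite inE => /andP[/VP[a zE] /eqP ztr]; rewrite -cardV //.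
pose g0 := y ^+ i + x * (w' * a).
have g0z : (g0 - y ^+ i) * star (y ^+ i) = z.
  rewrite /g0 zE star_yX.
  transitivity (w ^+ i * w' * (x * y ^+ i * a)); first by ring.
  by rewrite ww' mul1r.
have gensE h : (y ^+ i + x * h - y ^+ i) * star (y ^+ i) = z ->
    y ^+ i + x * h \in gens j.
  move=> hz; apply/gensP; split; first by exists h.
  move: ztr; rewrite -hz => /eqP; rewrite -subr_eq0 opprK => /eqP <-.
  rewrite !rmorphM rmorphB !rmorphD rmorphM star_x starK /e.
  transitivity (y ^+ i * star (y ^+ i) + x * h * star (y ^+ i) +
     x * star h * y ^+ i + x * x * (h * star h)); first by ring.
  by rewrite xx; ring.
apply: (card_bij (f := fun g => g - g0) (g := fun v => v + g0)) => g.
  rewrite inE => /andP[/gensP[[h gE] _] /eqP gz]; rewrite -/i in gE.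
  split; last by rewrite subrK.
  have : x * y ^+ i * (h - w' * a) = 0.
    apply: (invertible_cancel wi_unit); move: gz; rewrite -g0z gE /g0 star_yX.
    move/eqP; rewrite -subr_eq0 => /eqP <-; ring.
  case/(ann_xy leiN)=> b [c hE]; rewrite i_sub in hE.
  apply/VP; exists b; transitivity (x * (h - w' * a)).
    by rewrite gE /g0; ring.
  by rewrite hE mulrDr [x * (x * _)]mulrA xx mul0r addr0 mulrA.
case/VP=> b ->; split; last by rewrite addrK.
have E : (x * y ^+ j * b + g0 - y ^+ i) * star (y ^+ i) = z.
  rewrite -g0z -addrA mulrDl star_yX.
  have -> : x * y ^+ j * b * (w ^+ i * y ^+ i)
      = x * (y ^+ j * y ^+ i) * b * w ^+ i.
    by ring.
  by rewrite -exprD addnC subnK // xyN !mul0r add0r.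
rewrite inE E eqxx andbT.
have gE : x * y ^+ j * b + g0 = y ^+ i + x * (w' * a + y ^+ j * b).
  by rewrite /g0; ring.
by rewrite gE; apply: gensE; rewrite -gE.
Qed.

(** For each j <= M, dividing the number of generators by the class size q^(2(N-j)) leaves q^j
    ideals, and different j give disjoint families. *)
Lemma card_self_dual_ideals :
  #|[set I : {set A} | is_ideal I && (I == conj_ann star I)]|
    = (\sum_(j < M.+1) q ^ j)%N.
Proof.
have leN (j : 'I_M.+1) : (j <= N)%N.
  apply: leq_trans leMN; apply: leq_trans (_ : M <= _)%N.
    by rewrite -ltnS.
  by rewrite -addnn leq_addr.
pose B (j : 'I_M.+1) := code j @: gens j.
have -> : [set I : {set A} | is_ideal I && (I == conj_ann star I)]
    = \bigcup_j B j.
  apply/setP=> I; rewrite inE; apply/andP/bigcupP => [[Iid /eqP Isd]|].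
    have [j [g [lejM gG ->]]] := self_dual_code Iid Isd.
    have ltj : (j < M.+1)%N by [].
    by exists (Ordinal ltj) => //; apply: imset_f.
  case=> j _ /imsetP[g gG ->]; rewrite code_ideal; split=> //.
  by apply/eqP/code_self_dual.
have dis (i j : 'I_M.+1) : i != j -> [disjoint B i & B j].
  move=> neq; rewrite -setI_eq0; apply/set0Pn => -[I].
  rewrite inE => /andP[/imsetP[g gG ->] /imsetP[g' gG' E]].
  by case/eqP: neq; apply/val_inj/(code_inj (leN i) (leN j) gG gG' E).
rewrite -sum1_card partition_disjoint_bigcup //=.
apply: eq_bigr => j _; rewrite sum1_card.
have lejM : (j <= M)%N by rewrite -ltnS.
have := card_codes (leN j); rewrite card_gens // => /eqP.
by rewrite eqn_pmul2r ?expn_gt0 ?(ltnW q_gt1) // => /eqP ->.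
Qed.

End SelfDualIdeals.

(** * Galois rings *)

(* The integral form of ((x + y)^p - x^p - y^p) / p. *)
Definition binom_rest (A : comNzRingType) (p : nat) (x y : A) : A :=
  \sum_(1 <= i < p) (x ^+ (p - i) * y ^+ i) *+ ('C(p, i) %/ p).

(** * Binomial expansions when p^2 = 0 *)

Section BinomialPrime.
Variables (A : comNzRingType) (p : nat).
Hypothesis p_prime : prime p.
Implicit Types x y : A.

Lemma exprD_prime x y :
  (x + y) ^+ p = x ^+ p + y ^+ p + p%:R * binom_rest p x y.
Proof.
rewrite exprDn.
rewrite -(big_mkord xpredT (fun i => (x ^+ (p - i) * y ^+ i) *+ 'C(p, i))).
rewrite big_nat_recr //= big_ltn ?prime_gt0 // subn0 subnn bin0 binn !mulr1n.
rewrite !expr0 mulr1 mul1r addrAC; congr (_ + _).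
rewrite mulr_sumr; apply: eq_big_nat => i /andP[i_gt0 ltip].
rewrite mulr_natl -mulrnA divnK // prime_dvd_bin //; exact/andP.
Qed.

Hypothesis pp : p%:R * p%:R = 0 :> A.

(** Every term other than x^p contains the factor p^2. *)
Lemma exprDp_prime x y : (x + p%:R * y) ^+ p = x ^+ p.
Proof.
have pz k : (0 < k)%N -> p%:R * (p%:R * y) ^+ k = 0.
  by case: k => // k _; rewrite exprS !mulrA pp !mul0r.
rewrite exprD_prime -[RHS]addr0 -addrA; congr (_ + _).
rewrite mulr_sumr big1_seq ?addr0 => [|i /andP[_]]; last first.
  rewrite mem_index_iota => /andP[i_gt0 _].
  by rewrite -mulrnAl mulrCA pz // mulr0.
suff pz2 k : (1 < k)%N -> (p%:R * y) ^+ k = 0 by rewrite pz2 ?prime_gt1.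
by case: k => // k k_gt0; rewrite exprS mulrAC pz // mul0r.
Qed.

Lemma mulpXD k x y : p%:R * (x + p%:R * y) ^+ k = p%:R * x ^+ k.
Proof.
elim: k => // k IHk; rewrite !exprSr mulrA IHk.
transitivity (p%:R * (x ^+ k * x) + p%:R * p%:R * (x ^+ k * y)); first by ring.
by rewrite pp mul0r addr0.
Qed.

(** Additivity of Frobenius modulo p; here and below congruences modulo p are stated as equalities
    after multiplication by p. *)
Lemma mulp_frobD x y : p%:R * (x + y) ^+ p = p%:R * x ^+ p + p%:R * y ^+ p.
Proof.
by rewrite exprD_prime !mulrDr [p%:R * (p%:R * _)]mulrA pp mul0r addr0.
Qed.

Lemma mulp_frob_sum I (r : seq I) (P : pred I) (F : I -> A) :
  p%:R * (\sum_(i <- r | P i) F i) ^+ p = \sum_(i <- r | P i) p%:R * F i ^+ p.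
Proof.
elim: r => [|i r IHr].
  by rewrite !big_nil expr0n -(prednK (prime_gt0 p_prime)) mulr0.
by rewrite !big_cons; case: (P i); rewrite // mulp_frobD IHr.
Qed.

Lemma mulp_fermat n x : p%:R * (x *+ n) ^+ p = p%:R * (x ^+ p *+ n).
Proof.
have h : p%:R * (n%:R ^+ p) = p%:R * n%:R :> A.
  elim: n => [|n IHn].
    by rewrite expr0n -(prednK (prime_gt0 p_prime)) mulr0.
  by rewrite -natr1 mulp_frobD IHn expr1n mulrDr.
by rewrite -[x *+ n]mulr_natl exprMn mulrA h -mulrA [n%:R * _]mulr_natl.
Qed.

(** Modulo p, Frobenius fixes the integer coefficients of this polynomial and hence acts on its
    arguments. *)
Lemma mulp_binom_rest x y :
  p%:R * binom_rest p x y ^+ p = p%:R * binom_rest p (x ^+ p) (y ^+ p).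
Proof.
rewrite mulp_frob_sum mulr_sumr; apply: eq_bigr => i _.
by rewrite mulp_fermat exprMn -!exprM ![(_ * p)%N]mulnC.
Qed.

(* (1 + y)^(p^a) and 1 + y^(p^a) agree modulo p, so their p-th powers agree. *)
Lemma exprDn_prime_power a (y : A) :
  (1 + y) ^+ (p ^ a.+1) = (1 + y ^+ (p ^ a)) ^+ p.
Proof.
elim: a => [|a IHa]; first by rewrite expn1 expn0 expr1.
rewrite expnSr exprM IHa exprD_prime exprDp_prime expr1n -exprM.
by rewrite -expnSr.
Qed.

End BinomialPrime.

(** * The annihilator of p and a bound on the order *)

Section GaloisRing.

Variables (p s : nat) (R : finComNzRingType).
Hypotheses (p_prime : prime p) (R_galois : is_galois_ring p s R).

Let p2_gt1 : (1 < p ^ 2)%N.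
Proof. by rewrite -(exp1n 2) ltn_exp2r // prime_gt1. Qed.

Lemma galois_ring_pp : p%:R * p%:R = 0 :> R.
Proof.
case: R_galois => f [_ _ _ [phi _]].
by rewrite -natrM -(rmorph_nat phi) mulnn -polyC_natr pchar_Zp // rmorph0.
Qed.

Lemma Zp2_ann_p (z : 'Z_(p ^ 2)) : p%:R * z = 0 -> exists c, z = p%:R * c.
Proof.
rewrite -[z]natr_Zp -natrM => /(congr1 (@nat_of_ord _)).
rewrite val_Zp_nat //= => h.
have /dvdnP[k zk] : (p %| z)%N.
  by rewrite -(@dvdn_pmul2l p) ?prime_gt0 // mulnn /dvdn h.
by exists k%:R; rewrite zk natrM mulrC.
Qed.

(** Represent [r] by a remainder g' modulo [f]. Then p g' is a multiple of the monic [f] of smaller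
    degree, hence 0, and each coefficient of g' is divisible by p. *)
Lemma galois_ring_ann_p (r : R) : p%:R * r = 0 -> exists b, r = p%:R * b.
Proof.
case: R_galois => f [fm szf _ [phi [phi_surj phi_ker]]].
have [g <-] := phi_surj r => pr0.
have gE : phi g = phi (Pdiv.Ring.rmodp g f).
  rewrite {1}(Pdiv.RingMonic.rdivp_eq fm g) rmorphD.
  rewrite (_ : phi (_ * f) = 0) ?add0r //; apply/phi_ker.
  by exists (Pdiv.Ring.rdivp g f).
set g' := Pdiv.Ring.rmodp g f in gE.
have szg : (size g' < size f)%N by rewrite Pdiv.Ring.ltn_rmodp monic_neq0.
have /phi_ker[h hE] : phi (p%:R * g') = 0 by rewrite rmorphM rmorph_nat -gE.
have h0 : h = 0.
  apply/eqP; apply: contraTT szg => h_neq0; rewrite -leqNgt.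
  apply: leq_trans (_ : size (p%:R * g')%R <= _)%N.
    rewrite hE size_Mmonic // szf addnS /=.
    by rewrite -[X in (X <= _)%N]add1n leq_add2r size_poly_gt0.
  by rewrite mulr_natl -scaler_nat size_scale_leq.
have coefP i : exists c, g'`_i == p%:R * c.
  have /(congr1 (coefp i)) := hE; rewrite h0 mul0r /= coef0.
  rewrite [p%:R * _]mulr_natl coefMn -[_ *+ p]mulr_natl.
  by case/Zp2_ann_p=> c ->; exists c.
exists (phi (\poly_(i < size g') xchoose (coefP i))); rewrite gE.
rewrite -(rmorph_nat phi) -rmorphM; congr (phi _); apply/polyP=> i.
rewrite [in RHS]mulr_natl coefMn coef_poly -[X in _ = X]mulr_natl.
case: ltnP => [_|lei]; first exact/eqP/(xchooseP (coefP i)).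
by rewrite mulr0 nth_default.
Qed.

(** Remainders modulo [f] represent all elements; counting with the Teichmueller set later turns the
    bound into an equality. *)
Lemma card_galois_ring_le : (#|R| <= p ^ (2 * s))%N.
Proof.
case: R_galois => f [fm szf _ [phi [phi_surj phi_ker]]].
apply: leq_trans (_ : #|{poly_s 'Z_(p ^ 2)}| <= _)%N; last first.
  by rewrite card_npoly card_ord Zp_cast // expnM.
rewrite -(cardsT R) -(cardsT {poly_s 'Z_(p ^ 2)}).
apply: leq_trans (leq_imset_card (fun g : {poly_s 'Z_(p ^ 2)} => phi g) setT).
apply/subset_leq_card/subsetP=> r _; have [g <-] := phi_surj r.
have szg : (size (Pdiv.Ring.rmodp g f) <= s)%N.
  by rewrite -ltnS -szf Pdiv.Ring.ltn_rmodp monic_neq0.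
apply/imsetP; exists (npolyp s (Pdiv.Ring.rmodp g f)) => //.
rewrite npolypK // {1}(Pdiv.RingMonic.rdivp_eq fm g) rmorphD.
rewrite (_ : phi (_ * f) = 0) ?add0r //; apply/phi_ker.
by exists (Pdiv.Ring.rdivp g f).
Qed.

End GaloisRing.

(** * Teichmueller expansions and the conjugation *)

Section Teichmuller.

Variables (p s : nat) (R : finComNzRingType) (xi : R).
Hypotheses (p_prime : prime p) (s_gt0 : (0 < s)%N).
Hypotheses (pp : p%:R * p%:R = 0 :> R)
  (annp : forall r : R, p%:R * r = 0 -> exists b, r = p%:R * b)
  (cardR_le : (#|R| <= p ^ (2 * s))%N)
  (xi_order : (p ^ s - 1).-primitive_root xi).

Local Notation T := (teichmuller p s xi).

Let n_gt0 : (0 < p ^ s - 1)%N.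
Proof. by rewrite subn_gt0 -(exp1n s) ltn_exp2r // prime_gt1. Qed.

Let ps_gt0 : (0 < p ^ s)%N.
Proof. by rewrite expn_gt0 prime_gt0. Qed.

Let xi_unit : invertible xi.
Proof.
exists (xi ^+ (p ^ s - 1).-1); rewrite -exprS prednK //.
exact: prim_expr_order.
Qed.

Lemma teichmuller_unit : {in T, forall t, t = 0 \/ invertible t}.
Proof.
move=> t; rewrite in_setU1 => /orP[/eqP ->|/imsetP[i _ ->]]; first by left.
by right; apply: invertibleX.
Qed.

Lemma teichmuller_gen : xi \in T.
Proof.
rewrite in_setU1; apply/orP; right.
have lt1 : (1 %% (p ^ s - 1) < p ^ s - 1)%N by rewrite ltn_mod.
by apply/imsetP; exists (Ordinal lt1); rewrite //= (prim_expr_mod xi_order).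
Qed.

Let T_exp : {in T, forall t, t ^+ (p ^ s) = t}.
Proof.
move=> t; rewrite in_setU1 => /orP[/eqP ->|/imsetP[i _ ->]].
  by rewrite expr0n -(prednK ps_gt0).
rewrite exprAC; congr (_ ^+ _).
by rewrite -(subnK ps_gt0) exprD expr1 (prim_expr_order xi_order) mul1r.
Qed.

Let exp_modp (x c : R) : (x + p%:R * c) ^+ (p ^ s) = x ^+ (p ^ s).
Proof. by rewrite -(prednK s_gt0) expnS !exprM exprDp_prime. Qed.

(** The power p^s fixes [T] pointwise and erases multiples of p. *)
Lemma teichmuller_modp (t t' c : R) :
  t \in T -> t' \in T -> t = t' + p%:R * c -> t = t'.
Proof. by move=> tT t'T E; rewrite -(T_exp tT) E exp_modp T_exp. Qed.

Lemma card_teichmuller : #|T| = (p ^ s)%N.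
Proof.
rewrite cardsU1 card_imset ?card_ord; last first.
  move=> i j /eqP; rewrite (eq_prim_root_expr xi_order) !modn_small //.
  by move=> /eqP/val_inj.
suff -> : 0 \notin [set xi ^+ (i : nat) | i : 'I_(p ^ s - 1)].
  by rewrite addnC subnK.
apply/imsetP=> -[i _ /esym E]; have [v] := invertibleX i xi_unit.
by rewrite E mul0r => /esym/eqP; rewrite oner_eq0.
Qed.

Let P := [set p%:R * a | a : R].

(** Addition is injective on [T] times [P] = pR, and the order of R is the square of that of [P].
    The inequalities p^s |P| <= |R| <= p^(2s) then force |P| = p^s, so addition is also onto. *)
Let decT : #|R| = (p ^ (2 * s))%N /\
  forall a, exists t c, t \in T /\ a = t + p%:R * c.
Proof.
pose f z := z.1 + z.2 : R.
have inj_f : {in setX T P &, injective f}.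
  move=> [t _] [t' _] /setXP[/= tT /imsetP[c _ ->]]
    /setXP[/= t'T /imsetP[c' _ ->]].
  rewrite /f /= => E; have tt' : t = t'.
    apply: (@teichmuller_modp _ _ (c' - c)) => //.
    by rewrite mulrBr addrA -E addrK.
  by move: E; rewrite tt' => /addrI ->.
have cardP : #|R| = (#|P| * #|P|)%N := card_mul_ann pp annp.
have cfX : #|f @: setX T P| = (p ^ s * #|P|)%N.
  by rewrite (card_in_imset inj_f) cardsX card_teichmuller.
have leX : (p ^ s * #|P| <= #|R|)%N by rewrite -cfX max_card.
have P_gt0 : (0 < #|P|)%N by apply/card_gt0P; exists (p%:R * 0); apply: imset_f.
have leP : (p ^ s <= #|P|)%N by rewrite -(leq_pmul2r P_gt0) -cardP.
have cP : #|P| = (p ^ s)%N.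
  apply/eqP; rewrite eqn_leq leP andbT -leq_sqr -!mulnn -cardP.
  by rewrite -expnD addnn -mul2n.
have cR : #|R| = (p ^ (2 * s))%N by rewrite cardP cP -expnD addnn -mul2n.
split=> // a.
have /setP/(_ a) : f @: setX T P = setT.
  by apply/eqP; rewrite eqEcard subsetT cfX cP cardsT cR -expnD addnn -mul2n /=.
rewrite inE => /imsetP[[t _] /setXP[/= tT /imsetP[c _ ->]] ->].
by exists t, c.
Qed.

Lemma card_galois_ring : #|R| = (p ^ (2 * s))%N. Proof. by case: decT. Qed.

Lemma teichmuller_dec a : exists t c, t \in T /\ a = t + p%:R * c.
Proof. by case: decT. Qed.

(** Makes closure of [T] under products and powers immediate. *)
Lemma teichmullerE t : (t \in T) = (t ^+ (p ^ s) == t).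
Proof.
apply/idP/eqP => [/T_exp //|tE]; have [t' [c [t'T E]]] := teichmuller_dec t.
by rewrite -tE E exp_modp T_exp.
Qed.

Lemma teichmullerX t k : t \in T -> t ^+ k \in T.
Proof. by rewrite !teichmullerE exprAC => /eqP ->. Qed.

Lemma teichmullerM t t' : t \in T -> t' \in T -> t * t' \in T.
Proof. by rewrite !teichmullerE exprMn => /eqP -> /eqP ->. Qed.

(* [hconj] is [teich_pow (p ^ s./2)]. Exponents p^m are reached by iterating
   the case m = 1, where additivity follows from the binomial theorem. *)
Definition teich_pow (k : nat) (a : R) : R :=
  if [pick ab : R * R | [&& ab.1 \in T, ab.2 \in T & a == ab.1 + ab.2 * p%:R]]
    is Some ab then ab.1 ^+ k + ab.2 ^+ k * p%:R else 0.

(** Here [c] is arbitrary: p c^k depends only on c modulo p. *)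
Lemma teich_powE k t c : t \in T ->
  teich_pow k (t + p%:R * c) = t ^+ k + p%:R * c ^+ k.
Proof.
move=> tT; rewrite /teich_pow; case: pickP => [[a b] /=|].
  case/and3P=> aT bT /eqP E; have ta : t = a.
    apply: (@teichmuller_modp _ _ (b - c)) => //.
    by rewrite mulrBr addrA [p%:R * b]mulrC -E addrK.
  move: E; rewrite ta => /addrI E; congr (_ + _).
  have /annp[d dE] : p%:R * (c - b) = 0 by rewrite mulrBr E mulrC subrr.
  by rewrite -[c](subrK b) dE addrC mulpXD // mulrC.
have [b [d [bT ->]]] := teichmuller_dec c.
move/(_ (t, b)); rewrite /= tT bT /= mulrDr mulrA pp mul0r addr0 mulrC.
by rewrite eqxx.
Qed.

Let teich_pow1 : teich_pow 1 =1 id.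
Proof.
by move=> a; have [t [c [tT ->]]] := teichmuller_dec a; rewrite teich_powE.
Qed.

Let teich_pow_comp k l a : teich_pow k (teich_pow l a) = teich_pow (l * k) a.
Proof.
have [t [c [tT ->]]] := teichmuller_dec a.
by rewrite !teich_powE ?teichmullerX // !exprM.
Qed.

Let teich_pow_pM : {morph teich_pow p : a b / a * b}.
Proof.
move=> a b; have [t [c [tT ->]]] := teichmuller_dec a.
have [t' [c' [t'T ->]]] := teichmuller_dec b.
have -> : (t + p%:R * c) * (t' + p%:R * c') = t * t' + p%:R * (t * c' + c * t').
  transitivity (t * t' + p%:R * (t * c' + c * t') + p%:R * p%:R * (c * c')).
    by ring.
  by rewrite pp mul0r addr0.
rewrite !teich_powE ?teichmullerM // mulp_frobD // !exprMn.
have xx := pp; set x := p%:R : R in xx *.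
transitivity (t ^+ p * t' ^+ p + x * (t ^+ p * c' ^+ p + c ^+ p * t' ^+ p)
   + x * x * (c ^+ p * c' ^+ p)); last by ring.
by rewrite xx mul0r addr0 mulrDr.
Qed.

(** Let [r], [r'] be the p-th roots of [t], [t'] in [T]. Then (r + r')^p is the Teichmueller part of
    t + t', with p [binom_rest p r r'] as the difference. Frobenius turns this into the same term
    for [t], [t'], which is the correction in (t + t')^p. *)
Let teich_pow_pD : {morph teich_pow p : a b / a + b}.
Proof.
move=> a b; have [t [c [tT ->]]] := teichmuller_dec a.
have [t' [c' [t'T ->]]] := teichmuller_dec b.
pose r := t ^+ (p ^ s.-1); pose r' := t' ^+ (p ^ s.-1).
have rp : r ^+ p = t by rewrite -exprM -expnSr prednK ?T_exp.
have rp' : r' ^+ p = t' by rewrite -exprM -expnSr prednK ?T_exp.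
have eT : (r + r') ^+ p \in T.
  have [e [d [eT ->]]] := teichmuller_dec (r + r').
  by rewrite exprDp_prime // teichmullerX.
have := exprD_prime p_prime r r'; rewrite rp rp' => E.
have -> : t + p%:R * c + (t' + p%:R * c')
    = (r + r') ^+ p + p%:R * (c + c' - binom_rest p r r') by rewrite E; ring.
rewrite !teich_powE //.
have -> : (r + r') ^+ p ^+ p = (t + t') ^+ p by rewrite E exprDp_prime.
have H : p%:R * (c + c' - binom_rest p r r') ^+ p + p%:R * binom_rest p t t'
    = p%:R * c ^+ p + p%:R * c' ^+ p.
  by rewrite -rp -rp' -mulp_binom_rest // -mulp_frobD // subrK mulp_frobD.
rewrite exprD_prime // addrACA -H.
set X := p%:R * (_ ^+ p); set Y := p%:R * binom_rest _ _ _.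
by rewrite -!addrA [Y + X]addrC.
Qed.

Lemma teich_pow_morph m :
  {morph teich_pow (p ^ m) : a b / a + b} /\
  {morph teich_pow (p ^ m) : a b / a * b}.
Proof.
elim: m => [|m [IHD IHM]]; first by split=> a b; rewrite !teich_pow1.
split=> a b; rewrite expnSr -!teich_pow_comp.
  by rewrite IHD teich_pow_pD.
by rewrite IHM teich_pow_pM.
Qed.

Lemma teich_pow_nat1 k : (0 < k)%N -> teich_pow k 1 = 1.
Proof.
move=> k_gt0; have T1 : 1 \in T by rewrite teichmullerE expr1n.
have := teich_powE k 0 T1; rewrite mulr0 addr0 expr1n => ->.
by rewrite expr0n -(prednK k_gt0) mulr0 addr0.
Qed.

Hypothesis s_even : ~~ odd s.

Local Notation conj := (hconj p s xi).

Lemma hconj_monoid_morphism : monoid_morphism conj.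
Proof.
split; first by apply: teich_pow_nat1; rewrite expn_gt0 prime_gt0.
exact: (teich_pow_morph s./2).2.
Qed.

Lemma hconj_zmod_morphism : zmod_morphism conj.
Proof.
have D : {morph conj : a b / a + b} := (teich_pow_morph s./2).1.
move=> a b; apply/eqP; rewrite eq_sym subr_eq eq_sym; apply/eqP.
by rewrite -D subrK.
Qed.

(** Applied twice, the map raises both digits to the power p^s, which fixes [T]. *)
Lemma hconjK : involutive conj.
Proof.
move=> a; rewrite [LHS]teich_pow_comp -expnD addnn even_halfK //.
have [t [c [tT ->]]] := teichmuller_dec a.
rewrite teich_powE // T_exp //; have [b [d [bT ->]]] := teichmuller_dec c.
by rewrite mulpXD // T_exp // mulrDr [p%:R * (p%:R * d)]mulrA pp mul0r addr0.
Qed.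

Lemma hconj_teichmuller t : t \in T -> conj t = t ^+ (p ^ s./2).
Proof.
move=> tT; have := teich_powE (p ^ s./2) 0 tT; rewrite mulr0 addr0.
by rewrite expr0n eqn0Ngt expn_gt0 prime_gt0 //= mulr0 addr0.
Qed.

(* hconj does not fix xi modulo p: the order of xi exceeds p^(s/2) - 1. *)
Lemma hconj_gen_unit : invertible (xi - conj xi).
Proof.
have [t [c [tT E]]] := teichmuller_dec (xi - conj xi).
have [t0|tU] := teichmuller_unit tT; last first.
  rewrite E; apply: (@invertibleD_nilp _ _ _ 2) => //.
  by rewrite exprMn expr2 pp mul0r.
(* A zero Teichmueller part makes the two congruent modulo p, and both lie in [T]. *)
have : xi = conj xi.
  have xiT := teichmuller_gen.
  apply: (@teichmuller_modp _ _ c) => //.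
    by rewrite hconj_teichmuller ?teichmullerX.
  by rewrite -[p%:R * c]add0r -t0 -E addrC subrK.
rewrite hconj_teichmuller ?teichmuller_gen //.
have q_gt1 : (1 < p ^ s./2)%N.
  rewrite -(exp1n s./2) ltn_exp2r ?prime_gt1 // half_gt0.
  by case: s s_gt0 s_even => [|[]].
rewrite -{1}[xi]expr1 => /esym/eqP; rewrite (eq_prim_root_expr xi_order).
have h_gt0 : (0 < s./2)%N by rewrite half_gt0; case: s s_gt0 s_even => [|[]].
have q_lt : (p ^ s./2 < p ^ s)%N.
  rewrite ltn_exp2l ?prime_gt1 // -[X in (_ < X)%N](even_halfK s_even).
  by rewrite -addnn -[X in (X < _)%N]addn0 ltn_add2l.
have q_gt1' : (1 <= p ^ s./2)%N := ltnW q_gt1.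
rewrite eqn_mod_dvd // => dv.
have : (p ^ s - 1 <= p ^ s./2 - 1)%N by apply: dvdn_leq dv; rewrite subn_gt0.
by rewrite leqNgt ltn_sub2r // (ltn_trans q_gt1).
Qed.

End Teichmuller.

(** * Cyclic codes *)

HB.instance Definition _ (R : finComNzRingType) (h : {poly R}) :=
  Finite.on {poly %/ h}.

(** * The algebra of cyclic words, its involution and the form *)

Section CyclicAlgebra.

Variables (R : finComNzRingType) (n : nat).

(** The code length is n + 1, so that it is positive. *)
Definition cyc_poly : {poly R} := 'X^(n.+1) - 1%:P.
Local Notation h := cyc_poly.

Definition cyclic_algebra : finComNzRingType := {poly %/ h}.
Local Notation A := cyclic_algebra.

Definition cycC : {rmorphism R -> A} := qpolyC h.
Definition cycX : A := in_qpoly h 'X.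
Definition cyc_of_poly : {rmorphism {poly R} -> A} := in_qpoly h.
Local Notation C := cycC.
Local Notation X := cycX.

Let mk_h : mk_monic h = h.
Proof. by rewrite /mk_monic size_XnsubC // monicXnsubC. Qed.

Let size_A (a : A) : (size (polyn a) <= n.+1)%N.
Proof.
rewrite -ltnS; apply: leq_trans (size_mk_monic a) _.
by rewrite mk_h size_XnsubC.
Qed.

Lemma cyc_of_poly_small (f : {poly R}) :
  (size f <= n.+1)%N -> polyn (cyc_of_poly f) = f.
Proof. by move=> szf; apply: in_qpoly_small; rewrite mk_h size_XnsubC. Qed.

Lemma cyc_of_polyK (a : A) : cyc_of_poly (polyn a) = a.
Proof. by apply: val_inj; apply: cyc_of_poly_small. Qed.

Lemma cyc_of_polyC c : cyc_of_poly c%:P = C c.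
Proof.
by apply: val_inj; apply: cyc_of_poly_small; rewrite size_polyC; case: eqP.
Qed.

Let polyn_cyc f : polyn (cyc_of_poly f) = Pdiv.CommonRing.rmodp f h.
Proof. by rewrite -[X in Pdiv.CommonRing.rmodp _ X]mk_h. Qed.

Let h_eq0 : cyc_of_poly h = 0.
Proof.
by apply: val_inj; rewrite [LHS]polyn_cyc Pdiv.RingMonic.rmodpp ?monicXnsubC.
Qed.

Lemma cycXn : X ^+ n.+1 = 1.
Proof.
apply/eqP; rewrite -subr_eq0; apply/eqP; rewrite -h_eq0 rmorphB rmorphXn.
by rewrite cyc_of_polyC rmorph1.
Qed.

(* An evaluation at an n.+1-th root of unity factors through the quotient. *)
Lemma cyc_eval (B : comNzRingType) (phi : {rmorphism {poly R} -> B}) f :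
  phi 'X ^+ n.+1 = 1 -> phi (polyn (cyc_of_poly f)) = phi f.
Proof.
move=> phiX; have phih : phi h = 0.
  by rewrite rmorphB rmorphXn phiX rmorph1 subrr.
rewrite polyn_cyc.
rewrite [in RHS](Pdiv.RingMonic.rdivp_eq (monicXnsubC 1 (ltn0Sn n)) f).
by rewrite rmorphD rmorphM phih mulr0 add0r.
Qed.

Definition of_word (u : 'rV[R]_n.+1) : A := cyc_of_poly (rVpoly u).
Definition to_word (a : A) : 'rV[R]_n.+1 := poly_rV (polyn a).

Lemma of_wordK : cancel of_word to_word.
Proof.
by move=> u; rewrite /to_word cyc_of_poly_small ?rVpolyK // size_poly.
Qed.

Lemma to_wordK : cancel to_word of_word.
Proof. by move=> a; rewrite /of_word poly_rV_K ?cyc_of_polyK. Qed.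

Lemma of_wordE u : of_word u = \sum_(i < n.+1) C (u 0 i) * X ^+ i.
Proof.
have -> : of_word u = cyc_of_poly (\sum_(i < n.+1) (u 0 i)%:P * 'X^i).
  congr (cyc_of_poly _); rewrite /rVpoly poly_def; apply: eq_bigr => i _.
  by rewrite valK mul_polyC.
rewrite rmorph_sum; apply: eq_bigr => i _.
by rewrite rmorphM rmorphXn cyc_of_polyC.
Qed.

Lemma of_wordD r u v : of_word (r *: u + v) = C r * of_word u + of_word v.
Proof.
rewrite !of_wordE mulr_sumr -big_split; apply: eq_bigr => i _ /=.
by rewrite !mxE rmorphD rmorphM mulrDl mulrA.
Qed.

Lemma of_word0 : of_word 0 = 0.
Proof. by rewrite /of_word !raddf0. Qed.

Lemma cycXmod k : X ^+ (k %% n.+1) = X ^+ k.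
Proof. exact/expr_mod/cycXn. Qed.

Lemma of_word_shift u : of_word (cyclic_shift u) = X * of_word u.
Proof.
rewrite !of_wordE mulr_sumr (reindex_inj (@ordS_inj n.+1)).
apply: eq_bigr => i _.
by rewrite mxE ordSK /= cycXmod exprS; ring.
Qed.

Section Star.

Variable sigma : {rmorphism R -> R}.

(** X^n is the inverse of X in the quotient. *)
Definition star_eval : {rmorphism {poly R} -> A} :=
  (horner_eval (X ^+ n : A) \o map_poly (C \o sigma)).

Definition star_fun (a : A) : A := star_eval (polyn a).

Let star_evalX : star_eval 'X = X ^+ n.
Proof. by rewrite /= map_polyX /horner_eval hornerX. Qed.

Let star_evalXn : star_eval 'X ^+ n.+1 = 1.
Proof. by rewrite star_evalX exprAC cycXn expr1n. Qed.

Let star_fun_poly f : star_fun (cyc_of_poly f) = star_eval f.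
Proof. exact: cyc_eval star_evalXn. Qed.

Lemma star_zmod_morphism : zmod_morphism star_fun.
Proof.
move=> a b; rewrite -[a]cyc_of_polyK -[b]cyc_of_polyK -rmorphB !star_fun_poly.
by rewrite rmorphB.
Qed.

Lemma star_monoid_morphism : monoid_morphism star_fun.
Proof.
split=> [|a b].
  by rewrite -[X in star_fun X](rmorph1 cyc_of_poly) star_fun_poly rmorph1.
rewrite -[a]cyc_of_polyK -[b]cyc_of_polyK -rmorphM !star_fun_poly.
by rewrite rmorphM.
Qed.

HB.instance Definition _ :=
  GRing.isZmodMorphism.Build A A star_fun star_zmod_morphism.
HB.instance Definition _ :=
  GRing.isMonoidMorphism.Build A A star_fun star_monoid_morphism.

Definition star : {rmorphism A -> A} := star_fun.

Lemma starC c : star (C c) = C (sigma c).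
Proof.
rewrite -[C c]cyc_of_polyC [LHS]star_fun_poly /=.
by rewrite map_polyC /horner_eval hornerC.
Qed.

Lemma starX : star X = X ^+ n.
Proof. by rewrite -star_evalX; apply: star_fun_poly. Qed.

Lemma starXX : star X * X = 1.
Proof. by rewrite starX -exprSr cycXn. Qed.

Lemma cyc_starK : involutive sigma -> involutive star.
Proof.
move=> sigmaK a; rewrite -[a]to_wordK of_wordE !rmorph_sum.
apply: eq_bigr => i _; rewrite !rmorphM !rmorphXn !starC sigmaK; congr (_ * _).
congr (_ ^+ _); have := congr1 star starXX; rewrite rmorphM rmorph1 => E.
by rewrite -[LHS]mulr1 -starXX mulrA E mul1r.
Qed.

Definition ct (a : A) : R := (polyn a)`_0.

Let ctD : {morph ct : a b / a + b}.
Proof. by move=> a b; rewrite /ct poly_of_qpolyD coefD. Qed.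

Let ct0 : ct 0 = 0. Proof. by rewrite /ct coef0. Qed.

Let ctCX c k : (k < n.+1)%N -> ct (C c * X ^+ k) = c *+ (k == 0)%N.
Proof.
move=> ltk; have -> : C c * X ^+ k = cyc_of_poly (c%:P * 'X^k).
  by rewrite rmorphM rmorphXn cyc_of_polyC.
rewrite /ct cyc_of_poly_small ?coefCM ?coefXn.
  by rewrite eq_sym mulr_natr.
rewrite mul_polyC; apply: leq_trans (size_scale_leq _ _) _.
by rewrite size_polyXn.
Qed.

(** The product of X^i with the conjugate of X^j is X^(i + n j), and i + n j = i - j modulo n + 1,
    so only the terms with i = j reach the constant coefficient. *)
Lemma ct_form u v :
  ct (of_word u * star (of_word v)) = \sum_(i < n.+1) u 0 i * sigma (v 0 i).
Proof.
rewrite !of_wordE rmorph_sum mulr_suml (big_morph ct ctD ct0).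
apply: eq_bigr => i _; rewrite mulr_sumr (big_morph ct ctD ct0).
have E j : C (u 0 i) * X ^+ i * star (C (v 0 j) * X ^+ j)
    = C (u 0 i * sigma (v 0 j)) * X ^+ ((i + n * j) %% n.+1).
  rewrite !rmorphM rmorphXn starC starX cycXmod exprD exprM; ring.
under eq_bigr => j _ do rewrite E ctCX ?ltn_mod //.
rewrite (bigD1 i) //= -mulSn mulnC modnMl eqxx mulr1n big1 ?addr0 // => j neq.
suff -> : ((i + n * j) %% n.+1 == 0)%N = false by [].
apply: contraNF neq => /eqP h; apply/eqP/val_inj => /=.
have : (i + n * j + j = j %[mod n.+1])%N by rewrite -modnDml h add0n.
by rewrite -addnA -mulSnr mulnC -modnDmr modnMl addn0 !modn_small.
Qed.

Lemma ct_nondegenerate (a : A) : (forall b, ct (a * star b) = 0) -> a = 0.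
Proof.
move=> h; rewrite -[a]to_wordK -of_word0; congr (of_word _).
apply/rowP=> i; rewrite [RHS]mxE; have := h (of_word (delta_mx 0 i)).
rewrite -{1}[a]to_wordK ct_form (bigD1 i) //= big1 ?addr0 => [|j neq].
  by rewrite [delta_mx _ _ _ _]mxE !eqxx rmorph1 mulr1.
by rewrite [delta_mx _ _ _ _]mxE (negPf neq) andbF rmorph0 mulr0.
Qed.

End Star.

End CyclicAlgebra.

(** The term of index 1 is y, as its coefficient is p / p; all others are divisible by y^2. *)
Lemma binom_rest1_factor (A : comNzRingType) p (y : A) : prime p ->
  exists v, binom_rest p 1 y = y * (1 + y * v).
Proof.
move=> p_prime.
exists (\sum_(2 <= i < p) y ^+ i.-2 *+ ('C(p, i) %/ p)).
rewrite /binom_rest big_ltn ?prime_gt1 // expr1n mul1r bin1 divnn prime_gt0 //.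
rewrite mulr1n expr1 mulrDr mulr1; congr (_ + _).
rewrite !mulr_sumr; apply: eq_big_nat => i /andP[i_gt1 _].
rewrite expr1n mul1r !mulrnAr; congr (_ *+ _).
by case: i i_gt1 => [|[|i]] // _; rewrite exprS exprS.
Qed.

(** * The algebra in length p^(a+1), with y = X - 1 *)

Section CyclicAlgebraPrimePower.

Variables (p s a n : nat) (R : finComNzRingType).
Hypotheses (p_prime : prime p) (nE : (p ^ a.+1)%N = n.+1).
Hypotheses (pp : p%:R * p%:R = 0 :> R)
  (annp : forall r : R, p%:R * r = 0 -> exists b, r = p%:R * b).

Local Notation A := (cyclic_algebra R n).
Local Notation y := (cycX R n - 1).
Local Notation C := (cycC R n).

Lemma cyc_pp : p%:R * p%:R = 0 :> A.
Proof. by rewrite -(rmorph_nat C) -rmorphM pp rmorph0. Qed.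

Lemma cyc_annp (c : A) : p%:R * c = 0 -> exists b, c = p%:R * b.
Proof.
have wordM (d : A) i : to_word (p%:R * d) 0 i = p%:R * to_word d 0 i.
  rewrite -{1}[d]to_wordK -[_ * _]addr0 -(rmorph_nat C).
  rewrite -[X in _ + X](of_word0 R n).
  by rewrite -of_wordD of_wordK addr0 mxE.
move=> pc; have coefP i : exists b, to_word c 0 i == p%:R * b.
  have := wordM c i; rewrite pc -[X in to_word X](of_word0 R n) of_wordK mxE.
  by move/esym/annp=> [b ->]; exists b.
exists (of_word (\row_i xchoose (coefP i))).
rewrite -[LHS]to_wordK -[RHS]to_wordK; congr (of_word _); apply/rowP=> i.
by rewrite wordM of_wordK [X in _ * X]mxE; apply/eqP/(xchooseP (coefP i)).
Qed.

Lemma card_cyclic_algebra : #|A| = (#|R| ^ n.+1)%N.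
Proof.
rewrite -[n.+1]mul1n -card_mx -!cardsT.
apply: (card_bij (f := @to_word R n) (g := @of_word R n)) => c _.
  by rewrite to_wordK inE.
by rewrite of_wordK inE.
Qed.

(** A polynomial is congruent to its value at 1 modulo X - 1, and that value is then expanded in
    R. *)
Lemma cyc_dec (T : {set R}) :
    (forall r, exists t c, t \in T /\ r = t + p%:R * c) ->
  forall z : A, exists t b c,
    t \in [set C t | t in T] /\ z = t + y * b + p%:R * c.
Proof.
move=> decT z; have [f ->] : exists f, z = cyc_of_poly R n f.
  by exists (polyn z); rewrite cyc_of_polyK.
have /factor_theorem[g gE] : root (f - (f.[1])%:P) 1.
  by rewrite /root !hornerE subrr.
have [t [c [tT fE]]] := decT f.[1].
exists (C t), (cyc_of_poly R n g), (C c); split; first exact: imset_f.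
have -> : f = f.[1]%:P + g * ('X - 1%:P) by rewrite -gE addrC subrK.
rewrite rmorphD rmorphM rmorphB cyc_of_polyC {1}fE !cyc_of_polyC.
rewrite rmorphD rmorphM rmorph_nat rmorph1.
have -> : cyc_of_poly R n 'X = cycX R n by [].
by ring.
Qed.

(** With Y = y^(p^a), the relation X^(n+1) = 1 reads (1 + Y)^p = 1, that is Y^p = -p Y (1 + Y v).
    The last factor is a unit because Y^(2p) is a multiple of p^2 = 0. *)
Lemma cyc_y_pow : exists u, invertible u /\ y ^+ n.+1 = p%:R * u * y ^+ (p ^ a).
Proof.
set Y := y ^+ (p ^ a); have [v vE] := binom_rest1_factor Y p_prime.
have yn : y ^+ n.+1 = Y ^+ p by rewrite -nE expnSr exprM.
have := exprDn_prime_power p_prime cyc_pp a y.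
rewrite addrC subrK nE cycXn exprD_prime // expr1n vE -yn -/Y => /eqP.
rewrite -addrA addrC -subr_eq subrr => /eqP/esym/eqP.
rewrite addr_eq0 => /eqP E.
exists (- (1 + Y * v)); split; last by rewrite E; ring.
apply/invertibleN/(@invertibleD_nilp _ _ _ (p * 2)); first exact: invertible1.
rewrite exprMn exprM -yn E sqrrN.
have -> : (p%:R * (Y * (1 + Y * v))) ^+ 2 =
    p%:R * p%:R * (Y * (1 + Y * v)) ^+ 2 by ring.
by rewrite cyc_pp !mul0r.
Qed.

Lemma cyc_y_star (sigma : {rmorphism R -> R}) :
  exists w, invertible w /\ star n sigma y = w * y.
Proof.
exists (- star n sigma (cycX R n)); split.
  by apply: invertibleN; exists (cycX R n); apply: starXX.
by rewrite rmorphB rmorph1 mulNr mulrBr starXX mulr1 opprB.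
Qed.

Lemma card_cyc_self_dual_ideals q (sigma : {rmorphism R -> R}) (T : {set R})
    (alpha theta : R) :
    involutive sigma -> (1 < q)%N -> #|R| = (q ^ 4)%N -> (#|T| <= q ^ 2)%N ->
    {in T, forall t, t = 0 \/ invertible t} ->
    (forall r, exists t c, t \in T /\ r = t + p%:R * c) ->
    alpha + sigma alpha = 1 -> invertible theta -> sigma theta = - theta ->
  #|[set I : {set A} | is_ideal I && (I == conj_ann (star n sigma) I)]|
    = (\sum_(j < (p ^ a).+1) q ^ j)%N.
Proof.
move=> sigmaK q_gt1 cardR cardT T_unit decT alphaP theta_unit thetaN.
have [u [u_unit yN]] := cyc_y_pow; have [w [w_unit yw]] := cyc_y_star sigma.
have unitC r : invertible r -> invertible (C r).
  by case=> v rv; exists (C v); rewrite -rmorphM rv rmorph1.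
apply: (@card_self_dual_ideals _ _ p%:R y u w (C alpha) (C theta)
          [set C t | t in T] q n.+1) => //.
- exact: cyc_starK.
- exact: cyc_pp.
- exact: cyc_annp.
- by rewrite card_cyclic_algebra cardR expnM.
- exact: leq_trans (leq_imset_card _ _) cardT.
- move=> _ /imsetP[t /T_unit[->|tU] ->]; first by left; rewrite rmorph0.
  by right; apply: unitC.
- exact: cyc_dec.
- by rewrite rmorph_nat.
- by rewrite -nE expnS -mul2n leq_mul2r prime_gt1 ?orbT.
- by rewrite starC -rmorphD alphaP rmorph1.
- exact: unitC.
- by rewrite starC thetaN rmorphN.
Qed.

End CyclicAlgebraPrimePower.

(** * From cyclic codes to ideals *)

Section Transfer.

Variables (R : finComNzRingType) (n : nat) (sigma : {rmorphism R -> R}).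

Local Notation A := (cyclic_algebra R n).
Local Notation of_word := (@of_word R n).
Local Notation ideal_of C := (of_word @: C).

Let inj_w : injective of_word := can_inj (@of_wordK R n).

Lemma is_cyclic_codeP (C : {set 'rV[R]_n.+1}) :
  reflect [/\ 0 \in C, forall r u v, u \in C -> v \in C -> r *: u + v \in C
            & forall u, u \in C -> cyclic_shift u \in C]
          (is_cyclic_code C).
Proof.
apply: (iffP andP) => [[/andP[C0 /forallP CL] /forall_inP CS]|[C0 CL CS]].
  split=> // r u v uC vC.
  by have /forall_inP/(_ u uC)/forall_inP/(_ v vC) := CL r.
split; last exact/forall_inP.
rewrite /is_linear_code C0; apply/forallP=> r; apply/forall_inP=> u uC.
by apply/forall_inP=> v vC; apply: CL.
Qed.

Lemma cyclic_code_ideal (C : {set 'rV[R]_n.+1}) :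
  is_cyclic_code C = is_ideal (ideal_of C).
Proof.
apply/is_cyclic_codeP/is_idealP => [[C0 CL CS]|[I0 IL]].
  have I0 : 0 \in ideal_of C by rewrite -(of_word0 R n) imset_f.
  have IL r z z' : z \in ideal_of C -> z' \in ideal_of C ->
      cycC R n r * z + z' \in ideal_of C.
    move=> /imsetP[u uC ->] /imsetP[v vC ->]; rewrite -of_wordD.
    by apply: imset_f; apply: CL.
  have IX k z : z \in ideal_of C -> cycX R n ^+ k * z \in ideal_of C.
    elim: k z => [|k IHk] z zI; first by rewrite mul1r.
    rewrite exprSr -mulrA; apply: IHk; case/imsetP: zI => u uC ->.
    by rewrite -of_word_shift imset_f ?CS.
  split=> // r z z' zI z'I; rewrite -[r](@to_wordK R n) of_wordE mulr_suml.
  elim: (index_enum _) => [|i l IHl]; first by rewrite big_nil add0r.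
  by rewrite big_cons -addrA -mulrA IL ?IX.
have CE u : (u \in C) = (of_word u \in ideal_of C) by rewrite mem_imset.
split=> [|r u v|u]; rewrite !CE ?of_word0 //.
  by rewrite of_wordD; apply: IL.
by move=> uI; rewrite of_word_shift -[_ * _]addr0; apply: IL.
Qed.

(** If the constant coefficient of z [star v] vanishes for all v in an ideal, replacing v by b v
    kills the pairing of z [star v] with every b, and nondegeneracy gives z [star v] = 0. *)
Lemma ideal_conj_ann (C : {set 'rV[R]_n.+1}) : is_ideal (ideal_of C) ->
  ideal_of [set u : 'rV[R]_n.+1 |
             [forall v in C, \sum_(i < n.+1) u 0 i * sigma (v 0 i) == 0]]
    = conj_ann (star n sigma) (ideal_of C).
Proof.
case/is_idealP=> I0 IL; apply/setP=> z; rewrite -[z](@to_wordK R n).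
set u := to_word z; rewrite mem_imset // inE.
apply/forall_inP/conj_annP => [h _ /imsetP[v vC ->]|h v vC].
  apply: (@ct_nondegenerate _ _ sigma) => b; rewrite -mulrA -rmorphM.
  have : b * of_word v + 0 \in ideal_of C by apply: IL; rewrite ?imset_f.
  rewrite addr0 mulrC => /imsetP[v' v'C ->]; rewrite ct_form.
  exact/eqP/h.
by rewrite -ct_form h ?imset_f // /ct coef0.
Qed.

Lemma card_cyclic_self_dual :
  #|[set C : {set 'rV[R]_n.+1} | is_cyclic_code C &&
      (C == [set u : 'rV[R]_n.+1 |
             [forall v in C, \sum_(i < n.+1) u 0 i * sigma (v 0 i) == 0]])]|
  = #|[set I : {set A} | is_ideal I && (I == conj_ann (star n sigma) I)]|.
Proof.
have E (C : {set 'rV[R]_n.+1}) : is_cyclic_code C &&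
      (C == [set u : 'rV[R]_n.+1 |
             [forall v in C, \sum_(i < n.+1) u 0 i * sigma (v 0 i) == 0]])
   = is_ideal (ideal_of C) &&
      (ideal_of C == conj_ann (star n sigma) (ideal_of C)).
  rewrite cyclic_code_ideal; case: (boolP (is_ideal _)) => //= idC.
  by rewrite -ideal_conj_ann // (inj_eq (imset_inj inj_w)).
have KC : cancel (fun C : {set 'rV[R]_n.+1} => ideal_of C)
                 (fun I : {set A} => (@to_word R n) @: I).
  by move=> C; rewrite -imset_comp (eq_imset _ (@of_wordK R n)) imset_id.
have KI : cancel (fun I : {set A} => (@to_word R n) @: I)
                 (fun C : {set 'rV[R]_n.+1} => ideal_of C).
  by move=> I; rewrite -imset_comp (eq_imset _ (@to_wordK R n)) imset_id.
apply: (@card_bij {set 'rV[R]_n.+1} {set A} (fun C => ideal_of C)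
  (fun I => (@to_word R n) @: I)).
  by move=> C; rewrite !inE E KC.
by move=> I; rewrite !inE E KI.
Qed.

End Transfer.

Theorem theorem3p5 (p s a : nat) (R : finComNzRingType) (xi : R)
    (p_prime : prime p) (s_gt0 : (0 < s)%N) (a_gt0 : (0 < a)%N)
    (s_even : ~~ odd s)
    (R_galois : is_galois_ring p s R)
    (xi_order : (p ^ s - 1).-primitive_root xi) :
  num_hsd_cyclic p s xi (p ^ a)
    = (\sum_(0 <= i1 < (p ^ a.-1).+1) p ^ (s * i1)./2)%N
  /\
  ((\sum_(0 <= i1 < (p ^ a.-1).+1) p ^ (s * i1)./2)%N%:R : rat)
    = (p%:R ^+ (s * (p ^ a.-1 + 1))./2 - 1) / (p%:R ^+ s./2 - 1).
Proof.
have sE : s = (s./2).*2 by rewrite even_halfK.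
have half_sM k : ((s * k)./2 = s./2 * k)%N by rewrite {1}sE -doubleMl doubleK.
have m_gt0 : (0 < s./2)%N by rewrite half_gt0; case: (s) s_gt0 s_even => [|[]].
have q_gt1 : (1 < p ^ s./2)%N by rewrite -(exp1n s./2) ltn_exp2r // prime_gt1.
case: a a_gt0 => // a' _; rewrite [a'.+1.-1]/=.
split.
  have pp := galois_ring_pp p_prime R_galois.
  have annp := galois_ring_ann_p p_prime R_galois.
  have cardR_le := card_galois_ring_le p_prime R_galois.
  pose zm := GRing.isZmodMorphism.Build R R (hconj p s xi)
    (hconj_zmod_morphism p_prime s_gt0 pp annp cardR_le xi_order).
  pose mm := GRing.isMonoidMorphism.Build R R (hconj p s xi)
    (hconj_monoid_morphism p_prime s_gt0 pp annp cardR_le xi_order).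
  pose sigma : {rmorphism R -> R} := HB.pack (hconj p s xi) zm mm.
  have sigmaK : involutive sigma.
    exact: (hconjK p_prime s_gt0 pp annp cardR_le xi_order s_even).
  have [n nE] : exists n, (p ^ a'.+1)%N = n.+1.
    by exists (p ^ a'.+1).-1; rewrite prednK // expn_gt0 prime_gt0.
  pose theta := xi - sigma xi.
  have theta_unit : invertible theta.
    exact: (hconj_gen_unit p_prime s_gt0 pp annp cardR_le xi_order s_even).
  have thetaN : sigma theta = - theta by rewrite rmorphB sigmaK opprB.
  have [v tv] := theta_unit.
  have sv : sigma v = - v.
    have := congr1 sigma tv; rewrite rmorphM thetaN rmorph1 => E.
    by rewrite -[LHS]mul1r -tv mulrAC -[theta]opprK mulNr E mulN1r.
  (* As [sigma] negates [v], the trace of [xi * v] is (xi - sigma xi) v = theta v = 1. *)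
  have alphaP : xi * v + sigma (xi * v) = 1.
    by rewrite rmorphM sv mulrN -mulrBl.
  rewrite nE /num_hsd_cyclic (card_cyclic_self_dual n sigma).
  rewrite (card_cyc_self_dual_ideals p_prime nE pp annp sigmaK q_gt1 _ _
    (teichmuller_unit p_prime s_gt0 xi_order)
    (teichmuller_dec p_prime s_gt0 pp annp cardR_le xi_order)
    alphaP theta_unit thetaN).
  - by rewrite big_mkord; apply: eq_bigr => j _; rewrite half_sM expnM.
  - rewrite (card_galois_ring p_prime s_gt0 pp annp cardR_le xi_order) {1}sE.
    by rewrite -expnM -muln2 mulnCA mulnC -mulnA.
  - rewrite (card_teichmuller p_prime s_gt0 xi_order) {1}sE.
    by rewrite -expnM muln2.
have Q_neq0 : (p%:R ^+ s./2 - 1 : rat) != 0.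
  rewrite -natrX subr_eq0 -[X in _ != X]/(1%:R) Num.Theory.eqr_nat.
  by rewrite neq_ltn q_gt1 orbT.
(* As s is even, the halved exponents are multiples of s/2, so the sum is geometric with ratio
   p^(s/2). *)
apply: (mulIf Q_neq0); rewrite divfK // half_sM exprM addn1.
rewrite [RHS]subrX1 [RHS]mulrC.
congr (_ * _); rewrite natr_sum big_mkord; apply: eq_bigr => i _.
by rewrite half_sM expnM !natrX.
Qed.
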